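(* There is a (unique) action of the group $W(P)$ on the set $R(P)=\prod_{i=0}^p\prod_{j=1}^{k_i}K^{l_{i,j}}$ in which each generator $\sigma_{c_t}$ ($t\in\mathcal T(P)$) acts by the map $\sigma(t)$ and each generator $\sigma_{c(i,j,s)}$ acts by $\sigma(i,j,s)$ defined below; that is, these maps satisfy all relations of $W(P)$ (in particular $\sigma(t)^2=\mathrm{id}$ and $(\sigma(t)\sigma(t'))^{m}=\mathrm{id}$ with $m=2,3,4,6$ when $-\langle c_t,c_{t'}\rangle=0,1,2,3$, and the analogous braid relations involving $\sigma(i,j,s)$).
   Context: $K$ is a field of characteristic $0$. Combinatorial data: integer $p\ge0$; positive integers $k_i$ ($0\le i\le p$) and $l_{i,j}$ ($1\le j\le k_i$); nonnegative integers $e_i(j,j')$, symmetric in $j,j'$, with $e_i(j,j)=0$ and $e_i(j,j')\ge1$ for $j\neq j'$ (in the paper $e_i(j,j')=-\mathrm{wt}_{c_i}(w_{i,j}-w_{i,j'})$ is the degree of the difference of exponential factors at the singular point $c_i$, with $c_0=\infty$). $\mathcal T(P)=\prod_{i=0}^p\{1,\dots,k_i\}$. $Q(P)$ is the free $\mathbb Z$-module on $\mathcal C=\{c_t\}_{t\in\mathcal T(P)}\cup\{c(i,j,s)\mid 1\le s\le l_{i,j}-1\}$ with symmetric form $\langle c_t,c_{t'}\rangle=-\sum_{i=0}^pe_i(t_i,t'_i)-(p-1)+\#\{i\mid t_i=t'_i\}$, $\langle c_t,c(i,j,s)\rangle=-1$ if $t_i=j,s=1$ and $0$ otherwise, $\langle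 c(i,j,s),c(i',j',s')\rangle=2$ if equal, $-1$ if $(i,j)=(i',j')$ and $|s-s'|=1$, $0$ otherwise. $W(P)$ is the group generated by the reflections $\sigma_c(\alpha)=\alpha-\langle c,\alpha\rangle c$, $c\in\mathcal C$. Maps on $R(P)$ (elements $\nu=(\nu_{i,j,s})$): for $t\in\mathcal T(P)$ put $\nu(t)=\sum_{i=0}^p\nu_{i,t_i,1}$ and $\sigma(t)\nu=\tilde\nu$ with, for $i\ge1$: $\tilde\nu_{i,t_i,1}=\nu_{i,t_i,1}$, and $\tilde\nu_{i,j,s}=\nu_{i,j,s}-(e_i(j,t_i)+1)(1-\nu(t))$ for all other $(j,s)$; for $i=0$: $\tilde\nu_{0,t_0,1}=\nu_{0,t_0,1}+2(1-\nu(t))$, and $\tilde\nu_{0,j,s}=\nu_{0,j,s}-(e_0(j,t_0)-1)(1-\nu(t))$ for all other $(j,s)$. For $1\le s\le l_{i,j}-1$, $\sigma(i,j,s)$ swaps $\nu_{i,j,s}$ and $\nu_{i,j,s+1}$.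
   Formalization: The orders m=4,6 claimed for -<c_t,c_t'>=2,3 are false (σ(t)σ(t') then has infinite order, e.g. p=0, k_0=2, e_0(1,2)=3) and are dropped; what is proved is that the maps satisfy all relations of W(P), which includes σ(t)^2=id and m=2,3. *)

(* Defs.v *)
From HB Require Import structures.
From mathcomp Require Import all_boot all_order all_algebra.
Set Implicit Arguments. Unset Strict Implicit. Unset Printing Implicit Defensive.
Import Order.TTheory GRing.Theory Num.Theory.
Local Open Scope ring_scope.

(* Combinatorial data P = (p, k, l, e), with 1-based indices j and s:
   i ranges over 0..p, j over 1..k i, s over 1..l i j.
   e i j j' is e_i(j,j').  Values of k, l, e outside the valid range are
   irrelevant. *)

Definition data_ok (p : nat) (k : nat -> nat) (l : nat -> nat -> nat)
  (e : nat -> nat -> nat -> nat) : Prop :=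
  (forall i, (i <= p)%N -> (0 < k i)%N) /\
  (forall i j, (i <= p)%N -> (1 <= j <= k i)%N -> (0 < l i j)%N) /\
  (forall i j j', (i <= p)%N -> (1 <= j <= k i)%N -> (1 <= j' <= k i)%N ->
     e i j j' = e i j' j) /\
  (forall i j, (i <= p)%N -> (1 <= j <= k i)%N -> e i j j = 0%N) /\
  (forall i j j', (i <= p)%N -> (1 <= j <= k i)%N -> (1 <= j' <= k i)%N ->
     j != j' -> (1 <= e i j j')%N).

(* t in T(P) = prod_{i=0}^p {1..k_i}, represented as a list of length p+1. *)
Definition inT (p : nat) (k : nat -> nat) (t : seq nat) : bool :=
  (size t == p.+1) && all (fun i => (1 <= nth 0 t i <= k i)%N) (iota 0 p.+1).

Fixpoint Tlist (k : nat -> nat) (n : nat) : seq (seq nat) :=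
  match n with
  | 0 => [:: [::]]
  | n'.+1 => [seq rcons s j | s <- Tlist k n', j <- iota 1 (k n')]
  end.

(* Generators of Q(P): inl t = c_t, inr (i,j,s) = c(i,j,s). *)
Definition gen := (seq nat + (nat * nat * nat))%type.

Definition gen_ok (p : nat) (k : nat -> nat) (l : nat -> nat -> nat)
  (c : gen) : bool :=
  match c with
  | inl t => inT p k t
  | inr (i, j, s) => [&& (i <= p)%N, (1 <= j <= k i)%N & (1 <= s <= (l i j).-1)%N]
  end.

Definition genlist (p : nat) (k : nat -> nat) (l : nat -> nat -> nat) : seq gen :=
  [seq inl t | t <- Tlist k p.+1] ++
  flatten [seq [seq inr (i, j, s) | j <- iota 1 (k i), s <- iota 1 (l i j).-1]
            | i <- iota 0 p.+1].

Definition form (p : nat) (e : nat -> nat -> nat -> nat) (c c' : gen) : int :=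
  match c, c' with
  | inl t, inl t' =>
      - (\sum_(i < p.+1) (e i (nth 0 t i) (nth 0 t' i))%:Z) - (p%:Z - 1)
      + (count (fun i => nth 0 t i == nth 0 t' i) (iota 0 p.+1))%:Z
  | inl t, inr (i, j, s) | inr (i, j, s), inl t =>
      if (nth 0 t i == j) && (s == 1%N) then -1 else 0
  | inr (i, j, s), inr (i', j', s') =>
      if (i, j, s) == (i', j', s') then 2
      else if [&& i == i', j == j' & (s == s'.+1) || (s' == s.+1)] then -1
      else 0
  end.

(* Elements of Q(P) = Z^C: coordinate functions (only values on C matter). *)
Definition Qelt := gen -> int.

Definition pairing p k l e (c : gen) (a : Qelt) : int :=
  \sum_(c' <- genlist p k l) a c' * form p e c c'.

Definition refl p k l e (c : gen) (a : Qelt) : Qelt :=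
  fun c' => a c' - (if c' == c then pairing p k l e c a else 0).

Definition Qword p k l e (w : seq gen) (a : Qelt) : Qelt :=
  foldr (refl p k l e) a w.

(* The word is trivial in W(P) <= Aut(Q(P)). *)
Definition trivial_in_W p k l e (w : seq gen) : Prop :=
  forall a : Qelt, forall c, gen_ok p k l c -> Qword p k l e w a c = a c.

(* Elements nu = (nu_{i,j,s}) of R(P); only values at valid indices matter. *)
Definition Relt (K : fieldType) := nat -> nat -> nat -> K.

Definition R_index (p : nat) (k : nat -> nat) (l : nat -> nat -> nat)
  (i j s : nat) : bool :=
  [&& (i <= p)%N, (1 <= j <= k i)%N & (1 <= s <= l i j)%N].

Definition nu_t (K : fieldType) (p : nat) (nu : Relt K) (t : seq nat) : K :=
  \sum_(i < p.+1) nu i (nth 0%N t i) 1%N.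

Definition sigma_t (K : fieldType) (p : nat) (e : nat -> nat -> nat -> nat)
  (t : seq nat) (nu : Relt K) : Relt K :=
  fun i j s =>
    let d := 1 - nu_t p nu t in
    let ti := nth 0%N t i in
    if i == 0%N then
      (if (j == ti) && (s == 1%N) then nu i j s + 2%:R * d
       else nu i j s - ((e i j ti)%:Z - 1)%:~R * d)
    else
      (if (j == ti) && (s == 1%N) then nu i j s
       else nu i j s - ((e i j ti).+1)%:R * d).

Definition sigma_ijs (K : fieldType) (i0 j0 s0 : nat) (nu : Relt K) : Relt K :=
  fun i j s =>
    if (i == i0) && (j == j0) then
      (if s == s0 then nu i j s0.+1 else if s == s0.+1 then nu i j s0 else nu i j s)
    else nu i j s.

Definition sigma_gen (K : fieldType) (p : nat) (e : nat -> nat -> nat -> nat)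
  (c : gen) : Relt K -> Relt K :=
  match c with
  | inl t => sigma_t p e t
  | inr (i, j, s) => sigma_ijs i j s
  end.

Definition Rword (K : fieldType) p e (w : seq gen) (nu : Relt K) : Relt K :=
  foldr (sigma_gen p e) nu w.

(* Main.v *)
Require Import Defs.
From HB Require Import structures.
From mathcomp Require Import all_boot all_order all_algebra.
From mathcomp Require Import zify ring.
Import Order.TTheory GRing.Theory Num.Theory.
Local Open Scope ring_scope.
Set Implicit Arguments.
Unset Strict Implicit.
Unset Printing Implicit Defensive.

(* Both Q(P) and R(P) carry generalised reflections [x - lam_c(x) v_c] with
   [lam_c(x - a v_c') = lam_c(x) - a <c,c'>]; on R(P) one takes
   [lam_t(nu) = 1 - nu(t)] and [lam_(i,j,s)(nu) = nu_(i,j,s) - nu_(i,j,s+1)].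
   Such reflections satisfy the Coxeter relations attached to the symmetric
   generalised Cartan matrix <c,c'>. Since the form on Q(P) may be degenerate, one
   cannot compare the two actions directly; instead W(P), acting on Q(P), is shown
   to be the abstract Coxeter group, by the classical argument that a reduced word
   [w] with [l(w s) >= l(w)] sends the simple root of [s] to a nonnegative
   combination of simple roots. Hence a word trivial on Q(P) is a consequence of
   the Coxeter relations and is trivial on R(P). *)

(** * Words modulo the Coxeter relations *)

Section CoxeterWords.

Variables (T : eqType) (A : T -> T -> int).

(** Pairs with [A s t <= -2] get no relation: there the product of the two reflections has infinite
    order. *)
Inductive coxeter_sim : seq T -> seq T -> Prop :=
| sim_refl w : coxeter_sim w w
| sim_sym w w' : coxeter_sim w w' -> coxeter_sim w' w
| sim_trans w2 w1 w3 :
    coxeter_sim w1 w2 -> coxeter_sim w2 w3 -> coxeter_sim w1 w3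
| sim_cat u u' w w' :
    coxeter_sim u u' -> coxeter_sim w w' -> coxeter_sim (u ++ w) (u' ++ w')
| sim_quad s : coxeter_sim [:: s; s] [::]
| sim_comm s t : A s t = 0 -> coxeter_sim [:: s; t] [:: t; s]
| sim_braid s t : A s t = -1 -> coxeter_sim [:: s; t; s] [:: t; s; t].

Local Notation "u ~~~ w" := (coxeter_sim u w) (at level 70).

Definition reduced (w : seq T) :=
  forall w', w' ~~~ w -> (size w <= size w')%N.

(* [ev] records coordinates, so that functions are only ever compared pointwise *)
Definition reflection_action (K : comNzRingType) (X I : Type)
    (ev : X -> I -> K) (act : T -> X -> X)
    (lam : T -> X -> K) (v : T -> I -> K) : Prop :=
  [/\ forall c x i, ev (act c x) i = ev x i - lam c x * v c i,
      forall c x y, ev x =1 ev y -> lam c x = lam c y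
    & forall c c' x, lam c (act c' x) = lam c x - lam c' x * (A c c')%:~R].

Lemma foldr_act_ext (K : comNzRingType) (X I : Type) (ev : X -> I -> K)
    (act : T -> X -> X) (lam : T -> X -> K) (v : T -> I -> K) :
  reflection_action ev act lam v ->
  forall w x y, ev x =1 ev y -> ev (foldr act x w) =1 ev (foldr act y w).
Proof.
case=> evE lam_ext _ w x y exy; elim: w => //= c w IHw i.
by rewrite !evE IHw (lam_ext _ _ _ IHw).
Qed.

Hypothesis A_sym : forall s t, A s t = A t s.
Hypothesis A_diag : forall s, A s s = 2.

(** Each relation becomes a ring identity once the rule for [lam] under [act] is expanded, so the
    lemma serves Q(P) and R(P) alike. *)
Lemma foldr_sim (K : comNzRingType) (X I : Type) (ev : X -> I -> K)
    (act : T -> X -> X) (lam : T -> X -> K) (v : T -> I -> K) :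
  reflection_action ev act lam v ->
  forall w w', w ~~~ w' ->
  forall x, ev (foldr act x w) =1 ev (foldr act x w').
Proof.
move=> actP; case: (actP) => evE _ lamE w w'; elim=> {w w'} //.
- by move=> w w' _ IH x i; rewrite IH.
- by move=> w2 w1 w3 _ IH1 _ IH2 x i; rewrite IH1 IH2.
- move=> u u' w w' _ IHu _ IHw x i; rewrite !foldr_cat IHu.
  exact: (foldr_act_ext actP).
- by move=> s x i; rewrite /= !evE !lamE A_diag; ring.
- move=> s t Ast x i; rewrite /= !evE !lamE (A_sym t) Ast; ring.
- move=> s t Ast x i; rewrite /= !evE !lamE !A_diag (A_sym t) Ast; ring.
Qed.

Hypothesis A_off : forall s t, s != t -> A s t <= 0.

(** * Faithfulness of the action on roots *)

Section RootAction.

Variables (I : Type) (act : T -> (I -> int) -> I -> int)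
  (lam : T -> (I -> int) -> int) (v : T -> I -> int).
Hypothesis actP : reflection_action id act lam v.
Hypothesis lam_lin : forall c (a b : int) x y,
  lam c (fun i => a * x i + b * y i) = a * lam c x + b * lam c y.
Hypothesis lam_root : forall c s, lam c (v s) = A c s.
Hypothesis root_ge0 : forall s i, 0 <= v s i.

Lemma act_lin w (a b : int) x y :
  foldr act (fun i => a * x i + b * y i) w =1
  fun i => a * foldr act x w i + b * foldr act y w i.
Proof.
case: actP => evE lam_ext _; elim: w => //= c w IHw i.
rewrite !evE IHw (lam_ext _ _ _ IHw) lam_lin; ring.
Qed.

(** * Rank two: words in two letters *)

Section Dihedral.

Variables s t : T.
Hypothesis st : s != t.

Let plane (u : seq T) (a b : int) :=
  foldr act (v s) u =1 fun i => a * v s i + b * v t i.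

Lemma plane_s u a b : plane u a b -> plane (s :: u) (- a - A s t * b) b.
Proof.
case: actP => evE lam_ext _ Pu i /=.
rewrite evE (lam_ext _ _ _ Pu) Pu lam_lin !lam_root A_diag; ring.
Qed.

Lemma plane_t u a b : plane u a b -> plane (t :: u) a (- b - A s t * a).
Proof.
case: actP => evE lam_ext _ Pu i /=.
rewrite evE (lam_ext _ _ _ Pu) Pu lam_lin !lam_root A_diag A_sym; ring.
Qed.

Lemma plane_nil : plane [::] 1 0.
Proof. by move=> i /=; rewrite mul1r mul0r addr0. Qed.

(** Either alternative will contradict the minimality of an ambient reduced word ending in [u]. *)
Definition shortens (u : seq T) :=
  (exists2 u', u' ~~~ u & (size u' < size u)%N) \/
  (exists2 u', u' ~~~ rcons u s & (size u' < size u)%N).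

Lemma shortens_cons x u : shortens u -> shortens (x :: u).
Proof.
case=> -[u' su' lt_u']; [left|right]; exists (x :: u') => //.
  exact: (sim_cat (sim_refl [:: x]) su').
exact: (sim_cat (sim_refl [:: x]) su').
Qed.

Lemma shortens_quad x u : shortens (x :: x :: u).
Proof.
left; exists u => /=; last by lia.
exact: sim_sym (sim_cat (sim_quad x) (sim_refl u)).
Qed.

Lemma shortens_s : shortens [:: s].
Proof. by right; exists [::] => //=; apply: sim_sym (sim_quad s). Qed.

(** Invariant of the words that do not shorten, with the coordinates of the image of [v s]. For
    entries 0 and -1 these words form a finite list; otherwise the letter applied last, at the head
    of [u], marks the dominant coordinate. *)
Definition dihedral_state (u : seq T) (a b : int) : Prop :=
  if A s t == 0 then u = [::] /\ a = 1 /\ b = 0 \/ u = [:: t] /\ a = 1 /\ b = 0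
  else if A s t == -1 then
    [\/ u = [::] /\ a = 1 /\ b = 0, u = [:: t] /\ a = 1 /\ b = 1
      | u = [:: s; t] /\ a = 0 /\ b = 1]
  else 0 <= a /\ 0 <= b /\
    [\/ u = [::] /\ b <= a, (exists u', u = s :: u') /\ b <= a
      | (exists u', u = t :: u') /\ a <= b].

Lemma dihedral_state_ge0 u a b : dihedral_state u a b -> 0 <= a /\ 0 <= b.
Proof.
rewrite /dihedral_state; case: ifP => _; first by case=> -[_ [-> ->]].
by case: ifP => _; [case=> -[_ [-> ->]] | case=> a0 [b0 _]].
Qed.

Lemma dihedral_dichotomy u : all (mem [:: s; t]) u ->
  shortens u \/ exists a b, dihedral_state u a b /\ plane u a b.
Proof.
have A_le0 := A_off st.
elim: u => [_|x u IHu].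
  right; exists 1, 0; split; last exact: plane_nil.
  rewrite /dihedral_state; case: ifP => _; first by left.
  by case: ifP => _; [apply: Or31 | split=> //; split=> //; apply: Or31].
case/andP; rewrite !inE => xst /IHu [/(shortens_cons x)|]; first by left.
case=> a [b [st_u Pu]].
move: st_u; rewrite {1}/dihedral_state; case: (A s t =P 0) => [A0|nA0].
  case/orP: xst => /eqP->; case=> -[-> [Ea Eb]]; rewrite {}Ea {}Eb in Pu *.
  - by left; apply: shortens_s.
  (* Appending [s] shortens, since [s t s ~ t s s ~ t]. *)
  - left; right; exists [:: t] => //=.
    apply: sim_sym; apply: (@sim_trans [:: t; s; s]).
      exact: (sim_cat (sim_comm A0) (sim_refl [:: s])).
    exact: (sim_cat (sim_refl [:: t]) (sim_quad s)).
  - right; exists 1, 0; split.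
      by rewrite /dihedral_state A0 eqxx; right.
    by move: (plane_t plane_nil); rewrite A0 mul0r subr0 oppr0.
  - by left; apply: shortens_quad.
case: (A s t =P -1) => [A1|nA1].
  case/orP: xst => /eqP->; case=> -[Eu [Ea Eb]]; rewrite {}Eu {}Ea {}Eb in Pu *.
  - by left; apply: shortens_s.
  - right; exists 0, 1; split; last by move: (plane_s Pu); rewrite A1.
    by rewrite /dihedral_state A1 /=; apply: Or33.
  - by left; apply: shortens_quad.
  - right; exists 1, 1; split; last by move: (plane_t Pu); rewrite A1.
    by rewrite /dihedral_state A1 /=; apply: Or32.
  - by left; apply: shortens_quad.
  (* Here [t s t s ~ s t s s ~ s t]. *)
  - left; right; exists [:: s; t] => //=.
    apply: sim_sym; apply: (@sim_trans [:: s; t; s; s]).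
      rewrite A_sym in A1.
      exact: (sim_cat (sim_braid A1) (sim_refl [:: s])).
    exact: (sim_cat (sim_refl [:: s; t]) (sim_quad s)).
case=> a0 [b0 Hu].
(* If [b <= a], the new coordinate [- b - A s t * a] is at least [2 * a - b >= a]; the letter [s] is
   symmetric. *)
have A2 : A s t <= -2 by lia.
case/orP: xst => /eqP->; last first.
  have [[u' ->]|le_ba] : (exists u', u = t :: u') \/ b <= a.
    by case: Hu => -[Eu le_ab]; [right | right | left].
    by left; apply: shortens_quad.
  right; exists a, (- b - A s t * a); split; last exact: plane_t.
  rewrite /dihedral_state; do 2!case: ifP => [/eqP|_] //.
  split=> //; split; first by nia.
  by apply: Or33; split; [exists u | nia].
case: Hu => -[Eu le_ab].
- by rewrite Eu; left; apply: shortens_s.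
- by case: Eu => u' ->; left; apply: shortens_quad.
right; exists (- a - A s t * b), b; split; last exact: plane_s.
rewrite /dihedral_state; do 2!case: ifP => [/eqP|_] //.
split; first by nia.
by split=> //; apply: Or32; split; [exists u | nia].
Qed.

End Dihedral.

(* Split [w] as [v' u] with [u] a word in [s] and the last letter [t] of [w], and
   [v'] as short as possible: then [v'] keeps [v s] and [v t] nonnegative, while [u]
   sends [v s] into the cone spanned by [v s] and [v t]. *)
Lemma reduced_root_ge0 n w s : (size w <= n)%N -> reduced w ->
  (forall w', w' ~~~ rcons w s -> (size w <= size w')%N) ->
  forall i, 0 <= foldr act (v s) w i.
Proof.
elim: n w s => [|n IHn] w s; first by case: w => //= *; apply: root_ge0.
case/lastP: w => [|w0 t] le_wn redw redws i; first exact: root_ge0.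
have st : s != t.
  apply/eqP => Est; have := redws w0; rewrite Est size_rcons ltnn.
  case/(_ _)/notF; apply: sim_sym.
  rewrite -!cats1 -catA -{2}[w0]cats0.
  exact: (sim_cat (sim_refl _) (sim_quad t)).
set w := rcons w0 t in le_wn redw redws *.
apply/negPn/negP => neg.
(* Descent on the length of [v'] replaces the choice of a shortest one; it starts from [w0] and
   [[:: t]]. *)
have key m v' u : (size v' < m)%N -> v' ++ u ~~~ w ->
    (size v' + size u <= size w)%N -> (size v' < size w)%N ->
    all (mem [:: s; t]) u -> False.
  elim: m v' u => // m IHm v' u le_m sim_w le_w lt_w u_st.
  have redv' : reduced v'.
    move=> v'' sv.
    have := redw _ (sim_trans (sim_cat sv (sim_refl u)) sim_w).
    by rewrite size_cat; lia.
  have pos r : r \in [:: s; t] -> forall j, 0 <= foldr act (v r) v' j.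
    move=> r_st; apply: IHn => //; first by lia.
    (* A word [v''] shorter than [v'] and equivalent to [v' r] would give the factorisation of [w]
       into [v''] and [r u], already refuted. *)
    move=> v'' sv; rewrite leqNgt; apply/negP => lt_v.
    apply: (IHm v'' (r :: u)) => /=; [by lia | | by lia | by lia | exact/andP].
    apply: sim_trans sim_w; rewrite -cat1s catA.
    apply: sim_cat (sim_refl u).
    apply: (sim_trans (sim_cat sv (sim_refl [:: r]))).
    rewrite -cats1 -catA -{2}[v']cats0.
    exact: (sim_cat (sim_refl v') (sim_quad r)).
  case: (dihedral_dichotomy st u_st) => [[][u' su' lt_u']|[a [b [st_u Pu]]]].
  - have := redw _ (sim_trans (sim_cat (sim_refl v') su') sim_w).
    by rewrite size_cat; lia.
  - have: (size w <= size (v' ++ u'))%N; last by rewrite size_cat; lia.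
    apply: redws; apply: (sim_trans (sim_cat (sim_refl v') su')).
    by rewrite -!cats1 catA; apply: sim_cat sim_w (sim_refl _).
  have [a0 b0] := dihedral_state_ge0 st_u.
  move/negP: neg; apply.
  rewrite -(foldr_sim actP sim_w (v s) i) foldr_cat (foldr_act_ext actP _ Pu) act_lin.
  by rewrite addr_ge0 // mulr_ge0 // pos // !inE eqxx ?orbT.
apply: (key (size w0).+1 w0 [:: t]) => //=.
- by rewrite cats1; apply: sim_refl.
- by rewrite size_rcons addn1.
- by rewrite size_rcons.
- by rewrite !inE eqxx orbT.
Qed.

(** The conclusion is doubly negated because replacing a word by a shorter equivalent one, when it
    exists, is a classical case distinction. *)
Lemma root_action_faithful w :
  (forall s, exists2 i, 0 < v s i & foldr act (v s) w i = v s i) ->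
  ~ ~ (w ~~~ [::]).
Proof.
move: {2}(size w) (leqnn (size w)) => n.
elim: n w => [|n IHn] w le_wn triv nw.
  by apply: nw; case: w le_wn {triv} => // _; apply: sim_refl.
have redw : reduced w.
  move=> w' sw; rewrite leqNgt; apply/negP => lt_w.
  apply: (IHn w'); first by lia.
    move=> s; have [i vi wi] := triv s; exists i => //.
    by rewrite (foldr_sim actP sw).
  by move=> sw0; apply: nw; apply: sim_trans sw0; apply: sim_sym.
case/lastP: w => [|w0 s] in le_wn triv nw redw; first exact: nw (sim_refl _).
have [i vi wi] := triv s.
have: 0 <= foldr act (v s) w0 i.
  apply: (@reduced_root_ge0 (size w0)) => //.
    move=> w' sw.
    have := redw (rcons w' s); rewrite !size_rcons ltnS; apply.
    by rewrite -!cats1; apply: sim_cat sw (sim_refl _).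
  by move=> w' /redw; rewrite size_rcons; lia.
(* As [s] negates [v s], the positive value [v s i] would be the opposite of a nonnegative one. *)
move: wi; rewrite -cats1 foldr_cat /=.
case: (actP) => evE lam_ext _.
have E : act s (v s) =1 fun i => (-1) * v s i + 0 * v s i.
  by move=> j; rewrite evE lam_root A_diag; ring.
rewrite (foldr_act_ext actP _ E) act_lin; lia.
Qed.

End RootAction.

End CoxeterWords.

(** * Enumeration of the generators *)

Lemma Tlist_uniq k n : uniq (Tlist k n).
Proof.
elim: n => //= n IHn; apply: allpairs_uniq => //; first exact: iota_uniq.
by move=> [s j] [s' j'] _ _ /= /rcons_inj[-> ->].
Qed.

Lemma mem_Tlist k n t : size t = n ->
  (forall i, (i < n)%N -> (1 <= nth 0 t i <= k i)%N) -> t \in Tlist k n.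
Proof.
elim: n t => [|n IHn] t /=; first by move/size0nil->.
case/lastP: t => // t j; rewrite size_rcons => -[sz_t] ht.
apply/allpairsP; exists (t, j); split=> //=.
  apply: IHn => // i lt_in; have := ht i (ltnW lt_in).
  by rewrite nth_rcons sz_t lt_in.
by have := ht n (ltnSn n); rewrite nth_rcons sz_t ltnn eqxx mem_iota add1n ltnS.
Qed.

Section Datum.

Local Arguments Defs.form : simpl never.

Variables (p : nat) (k : nat -> nat) (l : nat -> nat -> nat).
Variable e : nat -> nat -> nat -> nat.
Hypothesis hP : data_ok p k l e.

Lemma inTP t i : inT p k t -> (i <= p)%N -> (1 <= nth 0 t i <= k i)%N.
Proof.
by case/andP=> _ /allP ht le_ip; apply: ht; rewrite mem_iota.
Qed.

Lemma genlist_uniq : uniq (genlist p k l).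
Proof.
rewrite /genlist cat_uniq map_inj_uniq ?Tlist_uniq ?andTb; last by move=> ? ? [].
apply/andP; split.
  apply/hasPn => c /flattenP[? /mapP[i _ ->]] /allpairsPdep[j [s [_ _ ->]]].
  by apply/negP => /mapP[].
elim: (iota 0 p.+1) (iota_uniq 0 p.+1) => //= i r IHr /andP[r'i /IHr u_r].
rewrite cat_uniq u_r andbT; apply/andP; split.
  apply: allpairs_uniq_dep => [|j _|]; rewrite ?iota_uniq //.
  by move=> [j s] [j' s'] _ _ /= [-> ->].
apply/hasPn => c /flattenP[? /mapP[i' r_i' ->]] /allpairsPdep[j [s [_ _ ->]]].
apply: contra r'i => /allpairsPdep[j' [s' [_ _ [Ei _ _]]]].
by rewrite -Ei.
Qed.

Lemma mem_genlist c : gen_ok p k l c -> c \in genlist p k l.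
Proof.
rewrite mem_cat; case: c => [t|[[i j] s]] ok_c; apply/orP.
  left; apply/mapP; exists t => //; case/andP: (ok_c) => /eqP sz_t _.
  by apply: mem_Tlist => // i lt_ip; apply: inTP.
right; case/and3P: ok_c => le_ip hj hs; apply/flattenP.
exists [seq inr (i, j, s) | j <- iota 1 (k i), s <- iota 1 (l i j).-1].
  by apply/mapP; exists i; rewrite // mem_iota.
by apply/allpairsPdep; exists j, s; rewrite !mem_iota !add1n !ltnS.
Qed.

(** * Reflections on Q(P) and the generalised Cartan matrix *)

Definition simple_root (c c' : gen) : int := (c' == c)%:R.

Lemma pairing_lin c (a b : int) x y :
  pairing p k l e c (fun c' => a * x c' + b * y c') =
  a * pairing p k l e c x + b * pairing p k l e c y.
Proof.
by rewrite /pairing !mulr_sumr -big_split; apply: eq_bigr => c' _ /=; ring.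
Qed.

Lemma pairing_root c s : gen_ok p k l s ->
  pairing p k l e c (simple_root s) = Defs.form p e c s.
Proof.
move=> ok_s; rewrite /pairing (bigD1_seq s) ?genlist_uniq ?mem_genlist //=.
rewrite /simple_root eqxx mul1r big1 ?addr0 // => c' /negPf->.
by rewrite mul0r.
Qed.

Lemma pairing_ext c x y : x =1 y -> pairing p k l e c x = pairing p k l e c y.
Proof. by move=> exy; apply: eq_bigr => c' _; rewrite exy. Qed.

(** The Cartan matrix axioms can fail for the form at indices out of range. *)
Definition okgen := {c : gen | gen_ok p k l c}.
Definition cartan (c c' : okgen) : int := Defs.form p e (val c) (val c').

Lemma refl_action :
  reflection_action cartan id (fun c => refl p k l e (val c))
    (fun c => pairing p k l e (val c)) (fun c => simple_root (val c)).
Proof.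
have reflE c x : refl p k l e c x =1
    fun c' => 1 * x c' + (- pairing p k l e c x) * simple_root c c'.
  by move=> c'; rewrite /refl /simple_root; case: eqP => _ /=; ring.
split=> [c x i|c x y|c c' x]; first by rewrite /= reflE; ring.
  exact: pairing_ext.
rewrite (pairing_ext _ (reflE _ _)) pairing_lin pairing_root ?(valP c') //.
by rewrite /cartan intz; ring.
Qed.

(** Gathers the form into one contribution per index [i], so that its properties are checked index
    by index. *)
Lemma form_inl t t' : Defs.form p e (inl t) (inl t') =
  \sum_(i < p.+1) ((nth 0%N t i == nth 0%N t' i)%:Z
                   - (e i (nth 0%N t i) (nth 0%N t' i))%:Z) - (p%:Z - 1).
Proof.
have -> : \sum_(i < p.+1) ((nth 0%N t i == nth 0%N t' i)%:Z -
      (e i (nth 0%N t i) (nth 0%N t' i))%:Z) =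
    (count (fun i => nth 0%N t i == nth 0%N t' i) (iota 0 p.+1))%:Z -
    \sum_(i < p.+1) (e i (nth 0%N t i) (nth 0%N t' i))%:Z.
  rewrite sumrB -sum1_count -[iota 0 p.+1]/(index_iota 0 p.+1).
  rewrite big_mkord (big_morph _ PoszD (erefl (Posz 0))).
  by congr (_ - _); rewrite [RHS]big_mkcond; apply: eq_bigr => i _; case: eqP.
by rewrite /Defs.form; ring.
Qed.

Lemma cartan_sym c c' : cartan c c' = cartan c' c.
Proof.
case: hP => _ [_ [e_sym _]]; rewrite /cartan.
case: c c' => [[t|[[i j] s]] /= ok_c] [[t'|[[i' j'] s']] /= ok_c'] //.
  rewrite !form_inl; congr (_ - _); apply: eq_bigr => i _.
  have le_ip : (i <= p)%N by rewrite -ltnS.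
  by rewrite eq_sym e_sym ?inTP.
rewrite /Defs.form !(eq_sym (i', j', s')) (eq_sym i') (eq_sym j') (orbC (s' == _)).
by [].
Qed.

Lemma cartan_diag c : cartan c c = 2.
Proof.
case: hP => _ [_ [_ [e_diag _]]]; rewrite /cartan.
case: c => [[t|[[i j] s]] /= ok_c]; last by rewrite /Defs.form eqxx.
rewrite form_inl (eq_bigr (fun=> 1)) => [|i _].
  rewrite sumr_const card_ord; lia.
by rewrite eqxx e_diag ?subr0 ?inTP // -ltnS.
Qed.

(** An index where [t] and [t'] differ contributes at most -1 and the [p] others at most 1 each,
    which the shift [p - 1] absorbs. *)
Lemma cartan_off c c' : c != c' -> cartan c c' <= 0.
Proof.
case: hP => _ [_ [_ [e_diag e_pos]]]; rewrite -val_eqE /cartan.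
case: c c' => [[t|[[i j] s]] /= ok_c] [[t'|[[i' j'] s']] /= ok_c'] ne_c.
- have [i ne_i] : exists i : 'I_p.+1, nth 0%N t i != nth 0%N t' i.
    apply/existsP; apply: contraR ne_c => /existsPn eq_t.
    case/andP: ok_c ok_c' => /eqP sz_t _ /andP[/eqP sz_t' _].
    apply/eqP; congr inl; apply: (@eq_from_nth _ 0%N); first by rewrite sz_t.
    by rewrite sz_t => i lt_ip; have /negPn/eqP := eq_t (Ordinal lt_ip).
  rewrite form_inl (bigD1 i) //= (negPf ne_i).
  have le_ip : (i <= p)%N by rewrite -ltnS.
  have e_i := e_pos i _ _ le_ip (inTP ok_c le_ip) (inTP ok_c' le_ip) ne_i.
  set S := \sum_(_ | _) _.
  have : S <= \sum_(j < p.+1 | j != i) 1.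
    apply: ler_sum => j _; case: eqP; lia.
  rewrite sumr_const cardC1 card_ord; lia.
- by rewrite /Defs.form; case: ifP.
- by rewrite /Defs.form; case: ifP.
- rewrite /Defs.form; case: eqP => [E|_]; last by case: ifP.
  by rewrite E eqxx in ne_c.
Qed.

(** * Reflections on R(P) *)

Variable K : fieldType.

Definition sigma_lam (c : gen) (nu : Relt K) : K :=
  match c with
  | inl t => 1 - nu_t p nu t
  | inr (i, j, s) => nu i j s - nu i j s.+1
  end.

Definition sigma_root (c : gen) (x : nat * nat * nat) : int :=
  let: (i, j, s) := x in
  match c with
  | inl t =>
      let ti := nth 0%N t i in
      if i == 0%N then (if (j == ti) && (s == 1%N) then -2 else (e i j ti)%:Z - 1)
      else (if (j == ti) && (s == 1%N) then 0 else (e i j ti)%:Z + 1)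
  | inr (i0, j0, s0) =>
      if (i == i0) && (j == j0) then (s == s0)%:Z - (s == s0.+1)%:Z else 0
  end.

Definition coord (nu : Relt K) (x : nat * nat * nat) : K :=
  let: (i, j, s) := x in nu i j s.

Lemma sigma_genE c nu x : coord (sigma_gen p e c nu) x =
  coord nu x - sigma_lam c nu * (sigma_root c x)%:~R.
Proof.
case: x c => [[i j] s] [t|[[i0 j0] s0]] /=.
  by rewrite /sigma_t; do 2!case: ifP => _;
     rewrite -?natr1 ?rmorph0 ?rmorphN ?rmorphB ?rmorphD /=; ring.
rewrite /sigma_ijs; case: ifP => [/andP[/eqP-> /eqP->]|_]; last by ring.
have [->|ne_s] := eqVneq s s0.
  by rewrite (_ : s0 == s0.+1 = false) /=; [ring | lia].
by have [->|ne_s'] := eqVneq s s0.+1; rewrite /=; ring.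
Qed.

Lemma sum_sigma_root c t : gen_ok p k l c -> inT p k t ->
  \sum_(i < p.+1) sigma_root c (nat_of_ord i, nth 0%N t i, 1%N) =
  - Defs.form p e (inl t) c.
Proof.
case: hP => _ [_ [_ [e_diag _]]].
case: c => [t'|[[i j] s]] ok_c ok_t.
  rewrite form_inl.
  (* The special rule at [i = 0] lowers that term by 2, so the constants add up to
     [p + 1 - 2 = p - 1], the shift in the form. *)
  have -> : \sum_(i < p.+1) sigma_root (inl t') (nat_of_ord i, nth 0%N t i, 1%N) =
    \sum_(i < p.+1) ((1 - (i == ord0)%:Z *+ 2) - ((nth 0%N t i == nth 0%N t' i)%:Z -
      (e i (nth 0%N t i) (nth 0%N t' i))%:Z)).
    apply: eq_bigr => i _; have le_ip : (i <= p)%N by rewrite -ltnS.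
    rewrite /= andbT -(inj_eq val_inj) /=.
    have [->|_] := eqVneq (nth 0%N t i); first by rewrite e_diag ?inTP //; case: eqP.
    by case: eqP => _ /=; ring.
  rewrite sumrB opprB; congr (_ - _).
  rewrite big_ord_recl (eq_bigr (fun=> 1)) // sumr_const card_ord /=; lia.
case/and3P: ok_c => le_ip _ /andP[s_gt0 _].
rewrite (bigD1 (inord i)) //= big1 => [|i' ne_i].
  rewrite inordK // eqxx addr0 /Defs.form.
  by case: eqP => _ //=; case: (s =P 1%N); lia.
by case: eqP => // Ei; rewrite -Ei inord_val eqxx in ne_i.
Qed.

(** For [c_t] the root is constant in [s] except at [(t_i, 1)], where [e i j j = 0] makes the jump
    -1 both for [i = 0] and for [i > 0]. *)
Lemma sigma_root_diff c i j s : gen_ok p k l c -> gen_ok p k l (inr (i, j, s)) ->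
  sigma_root c (i, j, s) - sigma_root c (i, j, s.+1) = Defs.form p e (inr (i, j, s)) c.
Proof.
case: hP => _ [_ [_ [e_diag _]]] ok_c ok_s.
case/and3P: (ok_s) => le_ip hj /andP[s_gt0 _].
rewrite /Defs.form; case: c ok_c => [t|[[i' j'] s']] ok_c /=.
  have [->|_] := eqVneq (nth 0%N t i) j.
    rewrite e_diag // eqSS (gtn_eqF s_gt0).
    by case: ifP => _; case: (s =P 1%N).
  by case: ifP; rewrite subrr.
rewrite !xpair_eqE; case: eqP => //= _; case: eqP => //= _.
rewrite eqSS (eq_sym s'); have [->|_] := eqVneq s s'.
  by rewrite ltn_eqF // gtn_eqF.
have [->|_] := eqVneq s s'.+1; first by rewrite gtn_eqF.
by case: eqP.
Qed.

Lemma sigma_action :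
  reflection_action cartan coord (fun c => sigma_gen p e (val c))
    (fun c => sigma_lam (val c)) (fun c x => (sigma_root (val c) x)%:~R).
Proof.
split=> [c x i|c x y exy|c c' x]; first exact: sigma_genE.
  have exy' i j s : x i j s = y i j s by have := exy (i, j, s).
  case: c => [[t|[[i j] s]] ok_c] /=; rewrite ?exy' //.
  by congr (1 - _); apply: eq_bigr => i _.
rewrite /cartan; case: c => [[t|[[i j] s]] ok_c] /=; last first.
  rewrite -sigma_root_diff ?(valP c') // rmorphB /=.
  have := sigma_genE (val c') x (i, j, s.+1); have := sigma_genE (val c') x (i, j, s).
  by rewrite /= => -> ->; ring.
(* The functional [1 - nu(t)] is affine with linear part [- nu(t)], hence the sign. *)
rewrite -[Defs.form _ _ _ _]opprK -sum_sigma_root ?(valP c') // rmorphN rmorph_sum.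
suff -> : nu_t p (sigma_gen p e (val c') x) t = nu_t p x t -
    sigma_lam (val c') x *
      \sum_(i < p.+1) (sigma_root (val c') (nat_of_ord i, nth 0%N t i, 1%N))%:~R.
  by ring.
rewrite mulr_sumr /nu_t -sumrB; apply: eq_bigr => i _.
exact: (sigma_genE (val c') x (nat_of_ord i, nth 0%N t i, 1%N)).
Qed.

End Datum.

(* The assignment sigma_{c} |-> sigma_gen c extends to an action of W(P)
   on R(P): every word in the generators that is trivial in W(P) acts
   trivially on R(P) (uniqueness is automatic, W(P) being generated by
   the sigma_c). *)
Theorem mainTheorem9 (K : fieldType) (hK : [pchar K] =i pred0)
  (p : nat) (k : nat -> nat) (l : nat -> nat -> nat)
  (e : nat -> nat -> nat -> nat) (hP : data_ok p k l e)
  (w : seq gen) (hw : all (gen_ok p k l) w)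
  (htriv : trivial_in_W p k l e w) :
  forall (nu : Relt K) (i j s : nat), R_index p k l i j s ->
    Rword p e w nu i j s = nu i j s.
Proof.
move=> nu i j s _.
have [w' Ew] : exists w' : seq (okgen p k l), w = map val w'.
  elim: w hw {htriv} => [|c w IHw] /=; first by exists [::].
  by case/andP=> ok_c /IHw[w' ->]; exists (exist _ c ok_c :: w').
(* A refutable goal is what the doubly negated faithfulness requires. *)
apply/eqP/negPn/negP => neq.
have A_sym := cartan_sym hP; have A_diag := cartan_diag hP.
have A_off := cartan_off hP.
have lam_root (c c' : okgen p k l) :
  pairing p k l e (val c) (simple_root (val c')) = cartan e c c'.
  by rewrite pairing_root // (valP c').
apply: (@root_action_faithful _ _ A_sym A_diag A_off _ _ _ _ (@refl_action p k l e)
          _ lam_root _ w').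
- by move=> c; apply: pairing_lin.
- by move=> c c'; rewrite /simple_root; case: eqP.
(* Triviality in W(P) is tested on each simple root at its own coordinate, where it equals 1. *)
- move=> c; exists (val c); first by rewrite /simple_root eqxx.
  have := htriv (simple_root (val c)) _ (valP c).
  by rewrite /Qword Ew foldr_map.
move=> w'1; case/negP: neq; apply/eqP.
have := foldr_sim A_sym A_diag (sigma_action hP K) w'1 nu (i, j, s).
by rewrite /Rword Ew foldr_map.
Qed.
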